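(* For all $n$, the commutator subgroups $FVB_n'=[FVB_n,FVB_n]$ and $FWB_n'=[FWB_n,FWB_n]$ of the flat virtual braid group $FVB_n$ and the flat welded braid group $FWB_n$ are finitely presented groups.
   Context: Here $n\ge 1$ is an integer. The flat virtual braid group $FVB_n$ is the group with generators $\sigma_i,\rho_i$ ($1\le i\le n-1$) and the following defining relations (for all indices for which they make sense): $\sigma_i\sigma_j=\sigma_j\sigma_i$ if $|i-j|>1$; $\sigma_i\sigma_{i+1}\sigma_i=\sigma_{i+1}\sigma_i\sigma_{i+1}$; $\sigma_i^2=1$; $\rho_i^2=1$; $\rho_i\rho_j=\rho_j\rho_i$ if $|i-j|>1$; $\rho_i\rho_{i+1}\rho_i=\rho_{i+1}\rho_i\rho_{i+1}$; $\sigma_i\rho_j=\rho_j\sigma_i$ if $|i-j|>1$; $\rho_i\rho_{i+1}\sigma_i=\sigma_{i+1}\rho_i\rho_{i+1}$. The flat welded braid group $FWB_n$ is the group with the same generators and relations, together with the additional (forbidden) relations $\rho_i\sigma_{i+1}\sigma_i=\sigma_{i+1}\sigma_i\rho_{i+1}$. *)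

(* Defs.v *)
From HB Require Import structures.
From mathcomp Require Import all_boot.
From mathcomp Require Import boolp.

Set Implicit Arguments.
Unset Strict Implicit.
Unset Printing Implicit Defensive.

Local Open Scope group_scope.
Local Open Scope quotient_scope.

(* A group given by a presentation < A | rel >: words over the alphabet of    *)
(* signed letters, modulo the congruence generated by free cancellation and   *)
(* by the equations [u = v] for [rel u v].                                    *)

(* [(a, false)] stands for a, and [(a, true)] for its formal inverse. *)
Notation word A := (seq (A * bool)).

Section Words.
Variable A : choiceType.

Definition winv (w : word A) : word A := rev [seq (x.1, ~~ x.2) | x <- w].

Inductive weq (rel : word A -> word A -> Prop) :
  word A -> word A -> Prop :=
| weq_refl u : weq rel u u
| weq_sym u v : weq rel u v -> weq rel v u
| weq_trans v u w : weq rel u v -> weq rel v w -> weq rel u w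
| weq_cat u u' v v' :
    weq rel u u' -> weq rel v v' -> weq rel (u ++ v) (u' ++ v')
| weq_cancel a b : weq rel [:: (a, b); (a, ~~ b)] [::]
| weq_rel u v : rel u v -> weq rel u v.

Lemma winv_cat u v : winv (u ++ v) = winv v ++ winv u.
Proof. by rewrite /winv map_cat rev_cat. Qed.

Lemma winvK : involutive winv.
Proof.
move=> u; rewrite /winv map_rev revK -map_comp -[RHS]map_id.
by apply: eq_map => -[a b] /=; rewrite negbK.
Qed.

Variable rel : word A -> word A -> Prop.

Lemma weq_winvr u : weq rel (u ++ winv u) [::].
Proof.
elim/last_ind: u => [|u [a b] IHu]; first exact: weq_refl.
rewrite -cats1 winv_cat -catA; apply: weq_trans IHu.
apply: weq_cat; first exact: weq_refl.
rewrite catA -[X in weq _ _ X]cat0s.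
by apply: weq_cat; [apply: weq_cancel | apply: weq_refl].
Qed.

Lemma weq_winvl u : weq rel (winv u ++ u) [::].
Proof. by rewrite -{2}[u]winvK; apply: weq_winvr. Qed.

Lemma weq_winv u v : weq rel u v -> weq rel (winv u) (winv v).
Proof.
move=> uv; apply: (@weq_trans _ ((winv u ++ v) ++ winv v)).
  rewrite -catA -[X in weq _ X _]cats0.
  apply: weq_cat; first exact: weq_refl.
  by apply/weq_sym/weq_winvr.
rewrite -[X in weq _ _ X]cat0s; apply: weq_cat; last exact: weq_refl.
apply: weq_trans (weq_winvl u); apply: weq_cat; first exact: weq_refl.
exact: weq_sym.
Qed.

Definition weqb (u v : word A) : bool := `[< weq rel u v >].

Lemma weqb_refl : reflexive weqb.
Proof. by move=> u; apply/asboolP/weq_refl. Qed.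

Lemma weqb_sym : symmetric weqb.
Proof. by move=> u v; apply/asboolP/asboolP => /weq_sym. Qed.

Lemma weqb_trans : transitive weqb.
Proof. by move=> v u w /asboolP uv /asboolP /(weq_trans uv) /asboolP. Qed.

Canonical weqb_equiv := EquivRel weqb weqb_refl weqb_sym weqb_trans.

Definition presented : Type := {eq_quot weqb}.

HB.instance Definition _ := Choice.on presented.
HB.instance Definition _ := Quotient.on presented.

Definition pmul (x y : presented) : presented :=
  \pi_presented (repr x ++ repr y).
Definition pone : presented := \pi_presented ([::] : word A).
Definition pinv (x : presented) : presented := \pi_presented (winv (repr x)).

Lemma pi_weqP u v :
  reflect (\pi_presented u = \pi_presented v) `[< weq rel u v >].
Proof. exact: (@eqmodP _ weqb_equiv). Qed.

Lemma weq_repr u : weq rel (repr (\pi_presented u)) u.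
Proof. by apply/asboolP/pi_weqP; rewrite reprK. Qed.

Lemma pi_cat u v :
  \pi_presented (u ++ v) = pmul (\pi_presented u) (\pi_presented v).
Proof.
by apply/pi_weqP/asboolP/weq_sym/weq_cat; apply: weq_repr.
Qed.

Lemma pi_winv u : \pi_presented (winv u) = pinv (\pi_presented u).
Proof. by apply/pi_weqP/asboolP/weq_sym/weq_winv/weq_repr. Qed.

Lemma presentedW (P : presented -> Prop) :
  (forall u, P (\pi_presented u)) -> forall x, P x.
Proof. by move=> Ppi x; rewrite -[x]reprK. Qed.

Lemma pmulA : associative pmul.
Proof.
by elim/presentedW=> u; elim/presentedW=> v; elim/presentedW=> w; rewrite -!pi_cat catA.
Qed.

Lemma pmul1 : left_id pone pmul.
Proof. by elim/presentedW=> u; rewrite -pi_cat. Qed.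

Lemma pmulr1 : right_id pone pmul.
Proof. by elim/presentedW=> u; rewrite -pi_cat cats0. Qed.

Lemma pmulV : left_inverse pone pinv pmul.
Proof.
by elim/presentedW=> u; rewrite -pi_winv -pi_cat; apply/pi_weqP/asboolP/weq_winvl.
Qed.

Lemma pmulrV : right_inverse pone pinv pmul.
Proof.
by elim/presentedW=> u; rewrite -pi_winv -pi_cat; apply/pi_weqP/asboolP/weq_winvr.
Qed.

HB.instance Definition _ :=
  isGroup.Build presented pmulA pmul1 pmulr1 pmulV pmulrV.

End Words.

Definition isomorphic (G H : groupType) : Prop :=
  exists f : {multiplicative G -> H}, bijective f.

Definition finitely_presented (G : groupType) : Prop :=
  exists (k : nat) (r : seq (word 'I_k * word 'I_k)),
    isomorphic (presented (fun u v => (u, v) \in r)) G.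

Section CommutatorSubgroup.
Variable G : groupType.

Definition generated_subgroup (X : G -> Prop) : {pred G} :=
  fun z => `[< forall S : {pred G},
                 group_closed S -> (forall x, X x -> x \in S) -> z \in S >].

Definition commutator_subgroup : {pred G} :=
  generated_subgroup (fun z => exists x y : G, z = [~ x, y]).

Lemma commutator_subgroup_closed : group_closed commutator_subgroup.
Proof.
split; first by apply/asboolP => S [].
move=> u v /asboolP uS /asboolP vS; apply/asboolP => S clS XS.
by case: (clS) => _; apply; [apply: uS | apply: vS].
Qed.

Definition commutator_group : Type := {x : G | x \in commutator_subgroup}.

HB.instance Definition _ := SubChoice.on commutator_group.
HB.instance Definition _ :=
  SubChoice_isSubGroup.Build G _ commutator_group commutator_subgroup_closed.

End CommutatorSubgroup.

Section FlatBraids.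
Variable n : nat.

(* The indices 1 <= i <= n-1 are shifted to 0 <= i < n-1. *)
Definition braid_gen : choiceType := ('I_n.-1 + 'I_n.-1)%type.

Definition sigma (i : 'I_n.-1) : word braid_gen := [:: (inl i, false)].
Definition rho (i : 'I_n.-1) : word braid_gen := [:: (inr i, false)].

(* |i - j| > 1 *)
Definition far (i j : 'I_n.-1) : bool := (i.+1 < j) || (j.+1 < i).

Inductive FVB_rel : word braid_gen -> word braid_gen -> Prop :=
| FVB_sigma_far (i j : 'I_n.-1) : far i j ->
    FVB_rel (sigma i ++ sigma j) (sigma j ++ sigma i)
| FVB_sigma_braid (i j : 'I_n.-1) : j = i.+1 :> nat ->
    FVB_rel (sigma i ++ sigma j ++ sigma i) (sigma j ++ sigma i ++ sigma j)
| FVB_sigma2 (i : 'I_n.-1) : FVB_rel (sigma i ++ sigma i) [::]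
| FVB_rho2 (i : 'I_n.-1) : FVB_rel (rho i ++ rho i) [::]
| FVB_rho_far (i j : 'I_n.-1) : far i j ->
    FVB_rel (rho i ++ rho j) (rho j ++ rho i)
| FVB_rho_braid (i j : 'I_n.-1) : j = i.+1 :> nat ->
    FVB_rel (rho i ++ rho j ++ rho i) (rho j ++ rho i ++ rho j)
| FVB_mixed_far (i j : 'I_n.-1) : far i j ->
    FVB_rel (sigma i ++ rho j) (rho j ++ sigma i)
| FVB_mixed (i j : 'I_n.-1) : j = i.+1 :> nat ->
    FVB_rel (rho i ++ rho j ++ sigma i) (sigma j ++ rho i ++ rho j).

Inductive FWB_rel : word braid_gen -> word braid_gen -> Prop :=
| FWB_FVB u v : FVB_rel u v -> FWB_rel u v
| FWB_forbidden (i j : 'I_n.-1) : j = i.+1 :> nat ->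
    FWB_rel (rho i ++ sigma j ++ sigma i) (sigma j ++ sigma i ++ rho j).

Definition FVB : groupType := presented FVB_rel.
Definition FWB : groupType := presented FWB_rel.

End FlatBraids.

(* Main.v *)
Require Import Defs.
From mathcomp Require Import all_boot.
From HB Require Import structures.
From mathcomp Require Import boolp.

(** In both groups every generator is an involution, so modulo commutators two
    occurrences of the same generator in a word cancel, and every coset of the
    commutator subgroup contains a word without repeated generators.  Hence the
    commutator subgroup has finite index
    ([commutator_covers_by_cosets]), and the theorem reduces to the
    Reidemeister-Schreier theorem: a finite-index subgroup of a finitely
    presented group is finitely presented
    ([finite_index_finitely_presented]).

    The latter is the algebraic form of the theory of covering spaces.  The
    presentation complex of [< A | rel >] has a finite cover whose vertices are
    the right cosets of the subgroup [K]; its edges are pairs (coset, letter),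
    and each relation lifts to one relation at every vertex.  The group of the
    cover at the coset of 1 is obtained from the edges by imposing the lifted
    relations, and by killing, for every coset, the lift of a fixed path that
    leads from the base vertex to it.  Lifting words of the big group
    ([rewriting]) and sending the edge from [q] labelled [a] to
    [t q * a * (t (q a))^-1], where [t] is the transversal, are mutually inverse
    homomorphisms ([cover_iso]).  The second family of
    relations kills the whole path to each coset instead of the edges of a
    spanning tree; this works for any transversal that represents the trivial
    coset by 1, where the classical form asks for a prefix-closed one.

    Finiteness of a set of relations over a finite alphabet is expressed by a
    bound on the length of the words involved.  This property is evident for the
    braid relations, and it is preserved by lifting since a lifted word has the
    length of the original one. *)

Set Implicit Arguments.
Unset Strict Implicit.
Unset Printing Implicit Defensive.

Local Open Scope group_scope.
Local Open Scope quotient_scope.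

(** * Groups given by presentations *)

Lemma multiplicative1 (G H : groupType) (f : {multiplicative G -> H}) :
  f 1 = 1.
Proof. by apply: (@mulgI _ (f 1)); rewrite -gmulfM !mulg1. Qed.

Lemma multiplicativeV (G H : groupType) (f : {multiplicative G -> H}) :
  {morph f : x / x^-1}.
Proof.
by move=> x; apply/esym/mulg1_eq; rewrite -gmulfM mulgV multiplicative1.
Qed.

Section Presentations.
Variables (A : choiceType) (rel : word A -> word A -> Prop).

(** The class of a word, typed so that the operations of the presented group
    apply to it. *)
Definition wcls (u : word A) : presented rel := \pi_(presented rel) u.

Lemma wcls_eqP u v : wcls u = wcls v <-> weq rel u v.
Proof. by split=> [/pi_weqP/asboolP | /asboolP/pi_weqP]. Qed.

Lemma wcls_repr x : wcls (repr x) = x.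
Proof. exact: reprK. Qed.

Lemma wcls_nil : wcls [::] = 1.
Proof. by []. Qed.

Lemma wcls_cat u v : wcls (u ++ v) = wcls u * wcls v.
Proof. exact: pi_cat. Qed.

Lemma wcls_inv u : wcls (winv u) = (wcls u)^-1.
Proof. exact: pi_winv. Qed.

Lemma wcls_cons x u : wcls (x :: u) = wcls [:: x] * wcls u.
Proof. by rewrite -wcls_cat. Qed.

Lemma wcls_neg a b : wcls [:: (a, ~~ b)] = (wcls [:: (a, b)])^-1.
Proof. by rewrite -wcls_inv. Qed.

Section Hom.
Variables (G : groupType) (f : A -> G).

Definition evalw (w : word A) : G :=
  \prod_(x <- w) (if x.2 then (f x.1)^-1 else f x.1).

Lemma evalw_weq u v : (forall u v, rel u v -> evalw u = evalw v) ->
  weq rel u v -> evalw u = evalw v.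
Proof.
move=> frel; elim=> {u v} //.
- by move=> u v w _ -> _ ->.
- by move=> u u' v v' _ eu _ ev; rewrite /evalw !big_cat /= -!/(evalw _) eu ev.
- move=> a b; rewrite /evalw !big_cons big_nil mulg1 /=.
  by case: b; rewrite /= ?mulgV ?mulVg.
Qed.

(** The universal property of a presentation. *)
Lemma presented_hom : (forall u v, rel u v -> evalw u = evalw v) ->
  exists h : {multiplicative presented rel -> G},
    forall w, h (wcls w) = evalw w.
Proof.
move=> frel; pose h (x : presented rel) := evalw (repr x).
have hE w : h (wcls w) = evalw w by apply: evalw_weq => //; apply: weq_repr.
have hM : {morph h : x y / x * y}.
  move=> x y; rewrite -[x]wcls_repr -[y]wcls_repr -wcls_cat !hE.
  by rewrite /evalw big_cat.
pose m := isMultiplicative.Build _ _ h hM.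
by exists (HB.pack_for {multiplicative presented rel -> G} h m).
Qed.

Lemma presented_hom_ext (g h : {multiplicative presented rel -> G}) :
  (forall a, g (wcls [:: (a, false)]) = h (wcls [:: (a, false)])) -> g =1 h.
Proof.
move=> gh x; rewrite -[x]wcls_repr; elim: (repr x) => [|[a b] w IHw].
  by rewrite wcls_nil !multiplicative1.
rewrite wcls_cons !gmulfM IHw; congr (_ * _).
by case: b; rewrite // -[true]/(~~ false) wcls_neg !multiplicativeV gh.
Qed.

End Hom.

End Presentations.

Lemma isomorphic_trans (G H K : groupType) :
  isomorphic G H -> isomorphic H K -> isomorphic G K.
Proof.
by move=> [f bf] [g bg]; exists (g \o f); apply: bij_comp.
Qed.

Definition relabel (A B : choiceType) (f : A -> B) : word A -> word B :=
  map (fun x => (f x.1, x.2)).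

Lemma evalw_relabel (A B : choiceType) (f : A -> B) rel (w : word A) :
  evalw (fun a => wcls rel [:: (f a, false)]) w = wcls rel (relabel f w).
Proof.
rewrite /evalw; elim: w => [|[a b] w IHw]; first by rewrite big_nil.
rewrite big_cons {}IHw [RHS]wcls_cons; congr (_ * _).
by case: b => //=; rewrite -wcls_neg.
Qed.

(** Over a finite alphabet this is finiteness of the set of relations, in a
    form that can be checked by looking at the shape of the relations. *)
Definition bounded_rel (A : choiceType) (rel : word A -> word A -> Prop) :=
  exists N, forall u v, rel u v -> size u <= N /\ size v <= N.

(** There are finitely many words of length at most [N], so the relations can be
    listed; the generators are numbered by [enum_rank]. *)
Lemma bounded_finitely_presented (A : finType)
    (rel : word A -> word A -> Prop) :
  bounded_rel rel -> finitely_presented (presented rel).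
Proof.
move=> [N relN].
pose f : A -> 'I_#|A| := enum_rank; pose g : 'I_#|A| -> A := enum_val.
have gfK : cancel (relabel f) (relabel g).
  by apply: mapK => -[a b]; rewrite /g /f /= enum_rankK.
have fgK : cancel (relabel g) (relabel f).
  by apply: mapK => -[a b]; rewrite /g /f /= enum_valK.
pose W : finType := N.-bseq ('I_#|A| * bool).
pose r := [seq (val p.1, val p.2) | p : W * W <-
    enum [pred p : W * W |
      `[< rel (relabel g (val p.1)) (relabel g (val p.2)) >]]].
have rP u v : (u, v) \in r <-> rel (relabel g u) (relabel g v).
  split=> [/mapP[p] | uv]; first by rewrite mem_enum => /asboolP ? [-> ->].
  have [] := relN _ _ uv; rewrite !size_map => su sv.
  by apply/mapP; exists (Bseq su, Bseq sv); rewrite // mem_enum; apply/asboolP.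
exists #|A|, r; set rr := fun u v => _.
have [|phi phiE] := @presented_hom _ rr _ (fun i => wcls rel [:: (g i, false)]).
  by move=> u v /rP uv; rewrite !evalw_relabel; apply/wcls_eqP/weq_rel.
have [|psi psiE] := @presented_hom _ rel _ (fun i => wcls rr [:: (f i, false)]).
  move=> u v uv; rewrite !evalw_relabel; apply/wcls_eqP/weq_rel/rP.
  by rewrite !gfK.
exists phi; exists psi => x; rewrite -[x]wcls_repr.
  by rewrite phiE evalw_relabel psiE evalw_relabel fgK.
by rewrite psiE evalw_relabel phiE evalw_relabel gfK.
Qed.

(** * The presentation of a finite-index subgroup *)

Section Cover.
Variables (A : finType) (rel : word A -> word A -> Prop).
Local Notation G := (presented rel).
Local Notation cls := (wcls rel).
Variables (K : groupType) (iota : {multiplicative K -> G}).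
Hypothesis iota_inj : injective iota.
Variables (Q : finType) (t : Q -> G) (c : G -> Q).
Hypothesis t1 : t (c 1) = 1.
Hypothesis tK : cancel t c.
(** The fibres of [c] are the right cosets of the image of [iota]. *)
Hypothesis cP : forall x y, c x = c y <-> exists k, iota k * x = y.

(** The path in the cover that starts at the coset of [x] and reads [w].  An
    inverse letter runs backwards along an edge, and edges are named after
    their origin: hence the coset recorded for [(a, true)] is the one reached
    after that letter. *)
Fixpoint lift (x : G) (w : word A) : word (Q * A)%type :=
  if w is y :: w' then
    ((c (if y.2 then x * cls [:: y] else x), y.1), y.2)
      :: lift (x * cls [:: y]) w'
  else [::].

(** The relations of [cover_lift] are the 2-cells of the cover; those of
    [cover_tree] contract a path from the base vertex to each vertex. *)
Inductive cover_rel : word (Q * A)%type -> word (Q * A)%type -> Prop :=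
| cover_lift q u v : rel u v -> cover_rel (lift (t q) u) (lift (t q) v)
| cover_tree q : cover_rel (lift 1 (repr (t q))) [::].

Local Notation P := (presented cover_rel).

Lemma size_lift x w : size (lift x w) = size w.
Proof. by elim: w x => //= y w IHw x; rewrite IHw. Qed.

Lemma cover_rel_bounded : bounded_rel rel -> bounded_rel cover_rel.
Proof.
move=> [N relN]; exists (maxn N (\max_q size (repr (t q)))).
move=> _ _ [q u v /relN[su sv] | q].
  by rewrite !size_lift !leq_max su sv.
by rewrite size_lift leq_max leq_bigmax orbT.
Qed.

Lemma coset_mulr x y z : c x = c y -> c (x * z) = c (y * z).
Proof. by move=> /cP[k <-]; apply/cP; exists k; rewrite mulgA. Qed.

Lemma coset_rep x : c (t (c x)) = c x.
Proof. exact: tK. Qed.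

Lemma coset_iota k x : c (iota k * x) = c x.
Proof. by apply/esym/cP; exists k. Qed.

Lemma lift_coset x y w : c x = c y -> lift x w = lift y w.
Proof.
elim: w x y => //= -[a b] w IHw x y cxy; congr ((_, _, _) :: _).
  by case: b => //=; apply: coset_mulr.
by apply: IHw; apply: coset_mulr.
Qed.

Lemma lift_cat x u v : lift x (u ++ v) = lift x u ++ lift (x * cls u) v.
Proof.
elim: u x => [|y u IHu] x /=; first by rewrite mulg1.
by rewrite IHu (wcls_cons _ _ u) mulgA.
Qed.

Definition lcls (x : G) (w : word A) : P := wcls cover_rel (lift x w).

Lemma lcls_cat x u v : lcls x (u ++ v) = lcls x u * lcls (x * cls u) v.
Proof. by rewrite /lcls lift_cat wcls_cat. Qed.

(** Homotopic paths have homotopic lifts: the lift of a cancelling pair is a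
    cancelling pair, and the lift of a relation is imposed at every vertex. *)
Lemma lcls_weq x u v : weq rel u v -> lcls x u = lcls x v.
Proof.
move=> uv; elim: uv x => {u v} //.
- by move=> u v w _ uv _ vw x; rewrite uv vw.
- by move=> u u' v v' /wcls_eqP eu IHu _ IHv x; rewrite !lcls_cat IHu IHv eu.
- move=> a b x; rewrite -[RHS]wcls_nil; apply/wcls_eqP => /=.
  case: b => /=; first exact: weq_cancel.
  rewrite -mulgA (_ : cls [:: (a, false)] * _ = 1) ?mulg1.
    exact: weq_cancel.
  by rewrite -[true]/(~~ false) wcls_neg mulgV.
- move=> u v uv x; apply/wcls_eqP.
  by rewrite -!(lift_coset _ (coset_rep x)); apply/weq_rel/cover_lift.
Qed.

Lemma lcls_coset x y w : c x = c y -> lcls x w = lcls y w.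
Proof. by rewrite /lcls => /lift_coset->. Qed.

Lemma lcls_inv x u : lcls (x * cls u) (winv u) = (lcls x u)^-1.
Proof.
apply/esym/mulg1_eq; rewrite -lcls_cat.
by rewrite (@lcls_weq _ _ [::]) //; apply: weq_winvr.
Qed.

Lemma lcls_tree q : lcls 1 (repr (t q)) = 1.
Proof. by apply/wcls_eqP/weq_rel/cover_tree. Qed.

Lemma lcls_letter q a :
  lcls (t q) [:: (a, false)] = wcls cover_rel [:: ((q, a), false)].
Proof. by rewrite /lcls /= tK. Qed.

(** An element of the subgroup is a loop at the base vertex; by [lcls_weq] its
    class does not depend on the word that is lifted. *)
Definition rewriting (k : K) : P := lcls 1 (repr (iota k)).

(** The second factor is read after the first one; as the first one is a loop,
    the lift of the second one starts again at the base vertex. *)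
Lemma rewritingM : {morph rewriting : k l / k * l}.
Proof.
move=> k l.
have e : weq rel (repr (iota (k * l))) (repr (iota k) ++ repr (iota l)).
  by apply/wcls_eqP; rewrite wcls_cat !wcls_repr gmulfM.
rewrite /rewriting (lcls_weq _ e) lcls_cat wcls_repr mul1g; congr (_ * _).
by apply: lcls_coset; rewrite -[iota k]mulg1 coset_iota.
Qed.

(** The loop goes to [q], follows the edge [(q, a)], and comes back to the base
    vertex; the first and the last part are killed by [cover_tree]. *)
Lemma rewriting_schreier k q a :
  iota k = t q * cls [:: (a, false)] * (t (c (t q * cls [:: (a, false)])))^-1 ->
  rewriting k = wcls cover_rel [:: ((q, a), false)].
Proof.
set g := cls _; set q' := c _ => kE.
have e : weq rel (repr (iota k))
    (repr (t q) ++ [:: (a, false)] ++ winv (repr (t q'))).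
  by apply/wcls_eqP; rewrite !wcls_cat wcls_inv !wcls_repr mulgA.
rewrite /rewriting (lcls_weq _ e) !lcls_cat lcls_tree mul1g wcls_repr mul1g.
rewrite lcls_letter (@lcls_coset _ (1 * cls (repr (t q')))).
  by rewrite lcls_inv lcls_tree invg1 mulg1.
by rewrite wcls_repr mul1g coset_rep.
Qed.

Lemma schreier_generator q a : exists k,
  iota k = t q * cls [:: (a, false)] * (t (c (t q * cls [:: (a, false)])))^-1.
Proof.
have /cP[k kE] := coset_rep (t q * cls [:: (a, false)]).
by exists k; apply: (canRL (mulgK _)) kE.
Qed.

(** The homomorphism from the group of the cover sends each edge to its Schreier
    generator.  By telescoping, a lifted word goes to the word itself, corrected
    at both ends by the transversal; this yields at once that the relations hold
    in the subgroup and that [rewriting] is a right inverse.  It is a left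
    inverse because it is one on the generators. *)
Lemma cover_iso : isomorphic P K.
Proof.
have [s sE] := choice (fun p => schreier_generator p.1 p.2).
have evalE x w :
    iota (evalw s (lift x w)) = t (c x) * cls w * (t (c (x * cls w)))^-1.
  elim: w x => [|[a b] w IHw] x /=.
    by rewrite /evalw big_nil multiplicative1 wcls_nil !mulg1 mulgV.
  rewrite /evalw big_cons -/(evalw _ _) gmulfM {}IHw /=.
  rewrite (wcls_cons _ _ w).
  set x' := x * cls [:: (a, b)]; set q := c (if b then x' else x).
  suff -> : iota (if b then (s (q, a))^-1 else s (q, a)) =
      t (c x) * cls [:: (a, b)] * (t (c x'))^-1.
    by rewrite !mulgA mulgVK.
  rewrite /q /x'; case: b {x' q}; last first.
    by rewrite sE /= (coset_mulr _ (coset_rep x)).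
  rewrite multiplicativeV sE /= -[true]/(~~ false) wcls_neg.
  set g := cls [:: (a, false)].
  rewrite (coset_mulr _ (coset_rep (x * g^-1))) mulgVK.
  by rewrite !invgM invgK mulgA.
have iotaE w : iota (evalw s (lift 1 w)) = cls w * (t (c (cls w)))^-1.
  by rewrite evalE t1 !mul1g.
have [|phi phiE] := @presented_hom _ cover_rel _ s.
  move=> _ _ [q u v uv | q]; apply: iota_inj.
    have uvE : cls u = cls v by apply/wcls_eqP/weq_rel.
    by rewrite !evalE uvE.
  by rewrite iotaE wcls_repr tK mulgV /evalw big_nil multiplicative1.
pose m := isMultiplicative.Build _ _ rewriting rewritingM.
pose psi := HB.pack_for {multiplicative K -> P} rewriting m.
exists phi; exists psi.
  apply: (presented_hom_ext (g := psi \o phi) (h := idfun)) => -[q a] /=.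
  apply: rewriting_schreier; rewrite phiE /evalw big_seq1 /=.
  by rewrite sE.
move=> k; apply: iota_inj; rewrite [psi k]/(lcls _ _) phiE iotaE wcls_repr.
by rewrite -{2}[iota k]mulg1 coset_iota t1 invg1 mulg1.
Qed.

End Cover.

(** With [I] finite, this says that the image of [iota] has finite index. *)
Definition covers_by_cosets (K G : groupType) (iota : {multiplicative K -> G})
    (I : Type) (t : I -> G) :=
  forall x, exists i k, iota k * t i = x.

(** The family [t] may hit a coset several times and need not contain 1: the
    lemma keeps one index per coset, and moves the representatives within their
    cosets so that the trivial coset is represented by 1. *)
Lemma normalized_transversal (K G : groupType)
    (iota : {multiplicative K -> G}) (I : finType) (t : I -> G) :
  covers_by_cosets iota t ->
  exists (Q : finType) (s : Q -> G) (c : G -> Q),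
    [/\ s (c 1) = 1, cancel s c
      & forall x y, c x = c y <-> exists k, iota k * x = y].
Proof.
move=> cover; pose D x i := `[< exists k, iota k * t i = x >].
have exD x : exists i, D x i by have [i ?] := cover x; exists i; apply/asboolP.
pose c0 x := xchoose (exD x).
have c0P x : exists k, iota k * t (c0 x) = x.
  by apply/asboolP/(xchooseP (exD x)).
have c0E x y : c0 x = c0 y <-> exists k, iota k * x = y.
  split=> [xy | [k <-]].
    have [[k kx] [l ly]] := (c0P x, c0P y); exists (l * k^-1).
    by rewrite gmulfM multiplicativeV -{1}kx xy mulgA mulgVK.
  apply: eq_xchoose => i; apply/asboolP/asboolP=> -[l lx].
    by exists (k * l); rewrite gmulfM -mulgA lx.
  by exists (k^-1 * l); rewrite gmulfM -mulgA lx multiplicativeV mulKg.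
have c0t x : c0 (t (c0 x)) == c0 x by apply/eqP/c0E/c0P.
pose Q : finType := {i | c0 (t i) == i}.
pose c x : Q := exist _ (c0 x) (c0t x).
have cE x y : c x = c y <-> exists k, iota k * x = y.
  by rewrite -c0E; split=> [[] | xy] //; apply: val_inj.
(* [(t (c0 1))^-1] lies in the image of [iota], so that multiplying by it on
   the left preserves right cosets. *)
exists Q, (fun q => (t (c0 1))^-1 * t (val q)), c; split=> //.
  by rewrite mulVg.
move=> q; apply: val_inj; rewrite /= -[RHS](eqP (valP q)).
have [k k1] := c0P 1.
apply/esym/c0E; exists k; congr (_ * _).
by rewrite -[LHS](mulgK (t (c0 1))) k1 mul1g.
Qed.

(** The Reidemeister-Schreier theorem. *)
Theorem finite_index_finitely_presented (A : finType)
    (rel : word A -> word A -> Prop) (K : groupType)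
    (iota : {multiplicative K -> (presented rel : groupType)})
    (I : finType) (t : I -> presented rel) :
  bounded_rel rel -> injective iota -> covers_by_cosets iota t ->
  finitely_presented K.
Proof.
move=> rel_bounded iota_inj /normalized_transversal[Q [s [c [s1 sK cP]]]].
have cover_bounded := cover_rel_bounded s c rel_bounded.
have [k [r PK]] := bounded_finitely_presented cover_bounded.
by exists k, r; apply: isomorphic_trans PK (cover_iso iota_inj s1 sK cP).
Qed.

(** * Groups generated by finitely many involutions *)

(** The element is [h] multiplied by the commutator of [x^-1] and
    [(h * y)^-1].  With [y = 1] this is invariance of the commutator subgroup
    under conjugation. *)
Lemma commutatorM_in (G : groupType) (x y h : G) :
  h \in @commutator_subgroup G ->
  x * (h * y) * x^-1 * y^-1 \in @commutator_subgroup G.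
Proof.
move=> hG'.
have -> : x * (h * y) * x^-1 * y^-1 = [~ x^-1, (h * y)^-1] * h.
  by rewrite commgEl conjgE !invgK invgM !mulgA mulgVK.
apply: (group_closedM (commutator_subgroup_closed _)) => //.
by apply/asboolP => S _; apply; exists x^-1, (h * y)^-1.
Qed.

Section Involutions.
Variables (A : finType) (rel : word A -> word A -> Prop).
Local Notation G := (presented rel : groupType).
Local Notation cls := (wcls rel).
Hypothesis gen2 : forall a, cls [:: (a, false); (a, false)] = 1.

Lemma cls_letterV a b : (cls [:: (a, b)])^-1 = cls [:: (a, false)].
Proof.
case: b; first by rewrite -wcls_neg.
by apply: mulg1_eq; rewrite -wcls_cat gen2.
Qed.

Lemma cls_letter_sign a b b' : cls [:: (a, b)] = cls [:: (a, b')].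
Proof. by apply: invg_inj; rewrite !cls_letterV. Qed.

(** By induction on the word: if the new letter [a] already occurs in
    [w = w1 a w2], it cancels with that occurrence, since [a w1 a^-1 w1^-1] is a
    commutator and the sign of [a] does not matter. *)
Lemma uniq_word_mod_commutators (u : word A) :
  exists2 w : word A, uniq (map fst w)
    & cls u * (cls w)^-1 \in @commutator_subgroup G.
Proof.
elim: u => [|[a b] u [w w_uniq uw]].
  exists [::]; rewrite // mulgV.
  by have [] := commutator_subgroup_closed G.
have uE : cls u = cls u * (cls w)^-1 * cls w by rewrite mulgVK.
move: (_ * _^-1) uw uE => h hG' uE.
case: (boolP (a \in map fst w)) => [/mapP[[a' b'] /= xw ea] | aw]; last first.
  exists ((a, b) :: w); first by rewrite /= aw.
  rewrite (wcls_cons _ _ u) (wcls_cons _ _ w) uE invgM !mulgA.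
  have := commutatorM_in (cls [:: (a, b)]) 1 hG'.
  by rewrite invg1 !mulg1 mulgK.
rewrite -ea in xw; case/splitPr: xw w_uniq uE => w1 w2 w_uniq uE.
exists (w1 ++ w2).
  apply: subseq_uniq w_uniq; apply: map_subseq.
  by apply: cat_subseq; last apply: subseq_cons.
rewrite wcls_cons uE !wcls_cat (wcls_cons _ _ w2).
rewrite (cls_letter_sign a b false) (cls_letter_sign a b' false).
have := commutatorM_in (cls [:: (a, false)]) (cls w1) hG'.
by rewrite cls_letterV invgM !mulgA mulgK.
Qed.

Lemma commutator_covers_by_cosets :
  covers_by_cosets
    (val : {multiplicative commutator_group G -> (G : groupType)})
    (fun w : #|A|.-bseq (A * bool) => cls w).
Proof.
move=> x; have [w w_uniq xw] := uniq_word_mod_commutators (repr x).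
have sw : size w <= #|A|.
  by rewrite -(size_map fst) -(card_uniqP w_uniq) max_card.
exists (Bseq sw), (exist (fun z => z \in @commutator_subgroup G) _ xw).
by rewrite /= mulgVK wcls_repr.
Qed.

Lemma commutator_finitely_presented :
  bounded_rel rel -> finitely_presented (commutator_group G).
Proof.
move=> rel_bounded.
apply: finite_index_finitely_presented rel_bounded val_inj _.
exact: commutator_covers_by_cosets.
Qed.

End Involutions.

(** * Flat virtual and flat welded braid groups *)

Lemma FVB_rel_size n u v : @FVB_rel n u v -> size u <= 3 /\ size v <= 3.
Proof. by case. Qed.

Lemma FWB_rel_bounded n : bounded_rel (@FWB_rel n).
Proof. by exists 3 => u v; case=> [{}u {}v /FVB_rel_size|]. Qed.

Lemma FVB_rel_square n (a : braid_gen n) :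
  FVB_rel [:: (a, false); (a, false)] [::].
Proof. by case: a => i; [apply: FVB_sigma2 | apply: FVB_rho2]. Qed.

Theorem theorem3p1 : forall n : nat, (1 <= n)%N ->
  finitely_presented (commutator_group (FVB n)) /\
  finitely_presented (commutator_group (FWB n)).
Proof.
move=> n _; split; apply: commutator_finitely_presented.
- by move=> a; apply/wcls_eqP/weq_rel/FVB_rel_square.
- by exists 3; apply: FVB_rel_size.
- by move=> a; apply/wcls_eqP/weq_rel/FWB_FVB/FVB_rel_square.
- exact: FWB_rel_bounded.
Qed.
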